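(* Let $a\in\mathbb{C}_p$, $R>0$, $D = D^{+}(a,R)$ and $f \in H(D)$. Let $b\in\mathbb{C}_p$ with $|b - a|_{p} = R$ and let $z \in D\setminus\mathcal{A}(a,b)$. Let $\alpha \in \mathbb{Z}_{\geq 0}$. Then the integral below exists and $$f(z) = \left(1 - \omega\left( \frac{a - z}{a - b}\right)^{p^{\alpha}}\right)\int_{\mathcal{A}(a,b),\Phi_{\alpha}}\frac{f(x)}{x - z}\,dx.$$
   Context: $p$ is an odd prime; $\mathbb{C}_p$ is the completion of an algebraic closure of $\mathbb{Q}_p$, with $|p|_p=1/p$. $D^+(c,r)$ is the closed disc with center $c$ and radius $r$. $H(D)$ is the set of functions on the disc $D$ given by a single power series convergent on $D$. Arc: for $a\ne b$ in $\mathbb{C}_p$ with $R=|a-b|_p$, the arc $\mathcal{A}(a,b)$ is the open disc $\{x : |x-b|_p<R\}$. Path sequence: a function $\varphi$ defined for all integers $k\ge k_0$ (some $k_0\in\mathbb{Z}^+$), with values in $\mathbb{Z}^+$ and strictly increasing. For $f:\mathcal{A}(a,b)\to\mathbb{C}_p$ put $A_{f,\varphi}(k)=p^{-\varphi(k)}\sum_{\zeta}(x-a)f(x)$, where $x=a+(b-a)\zeta$ and $\zeta$ runs through the $p^{\varphi(k)}$-th roots of unity. A non-empty family $\Phi$ of path sequences is interlocked if for all $\varphi_1,\varphi_2\in\Phi$ there are $\varphi_3\in\Phi$ and $k_0$ such that $\varphi_3(k)$, $k\ge k_0$, is a subsequence of both $\varphi_1$ and $\varphi_2$. For interlocked $\Phi$,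 $\int_{\mathcal{A}(a,b),\Phi}f(x)\,dx=L$ means: for every $\varepsilon>0$ there are $\varphi_\varepsilon\in\Phi$ and $K_\varepsilon$ with $|A_{f,\varphi_\varepsilon}(k)-L|_p<\varepsilon$ for all $k>K_\varepsilon$ (such $L$ is unique if it exists). For $\alpha\in\mathbb{Z}$, $\Phi_\alpha$ is the interlocked family $\{\varphi : \varphi(k)=\alpha+\lambda k,\ \lambda=1,2,\dots\}$. $\omega$ is the Teichmüller character: for $|x|_p=1$, $\omega(x)$ is the unique root of unity of order prime to $p$ with $|x-\omega(x)|_p<1$; $\omega(x)=0$ if $|x|_p<1$. *)

(* Defs.v *)
From HB Require Import structures.
From mathcomp Require Import all_boot all_order all_algebra.
From mathcomp Require Import all_classical all_reals all_analysis.

Set Implicit Arguments.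
Unset Strict Implicit.
Unset Printing Implicit Defensive.

Import Order.TTheory GRing.Theory Num.Theory.
Import numFieldNormedType.Exports.

Local Open Scope classical_set_scope.
Local Open Scope ring_scope.

Record abs_value (R : realType) (K : fieldType) := AbsValue {
  abs_fun :> K -> R;
  abs_ge0 : forall x, 0 <= abs_fun x;
  abs_eq0 : forall x, abs_fun x = 0 <-> x = 0;
  absM : forall x y, abs_fun (x * y) = abs_fun x * abs_fun y;
  abs_ultra : forall x y, abs_fun (x + y) <= Num.max (abs_fun x) (abs_fun y)
}.

Section Valued.
Variables (R : realType) (K : fieldType) (v : abs_value R K).

Definition abs_cvg (u : nat -> K) (l : K) : Prop :=
  (fun n => v (u n - l)) @ \oo --> (0 : R).

Definition abs_cauchy (u : nat -> K) : Prop :=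
  forall eps : R, 0 < eps -> exists N : nat,
    forall m n : nat, (N <= m)%N -> (N <= n)%N -> v (u m - u n) < eps.

Definition abs_complete : Prop :=
  forall u : nat -> K, abs_cauchy u -> exists l : K, abs_cvg u l.

Definition closed_disc (c : K) (r : R) : set K := [set x | v (x - c) <= r].

(* H(D) for D = D^+(c, r), the power series being centred at c.  The values
   of f outside D are irrelevant. *)
Definition HD (c : K) (r : R) : set (K -> K) :=
  [set f | exists u : nat -> K, forall x, closed_disc c r x ->
     abs_cvg (fun n => \sum_(i < n) u i * (x - c) ^+ i) (f x)].

Definition open_arc (a b : K) : set K := [set x | v (x - b) < v (a - b)].

End Valued.

Definition padic_abs (R : realType) (p : nat) (q : rat) : R :=
  if q == 0 then 0
  else (p%:R : R) ^ ((logn p `|denq q|%N)%:Z - (logn p `|numq q|%N)%:Z).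

(* L, via iota, is the completion of K, whose absolute value is vK.  vK is a
   bare function so that this also applies to padic_abs. *)
Definition is_completion (R : realType) (K L : fieldType)
    (vK : K -> R) (vL : abs_value R L) (iota : {rmorphism K -> L}) : Prop :=
  [/\ forall x, vL (iota x) = vK x,
      abs_complete vL
    & forall (y : L) (eps : R), 0 < eps -> exists x : K, vL (y - iota x) < eps].

(* (C, vC) is the completion of an algebraic closure Qpbar of the completion
   Qp of the rationals for the p-adic absolute value.  These conditions
   determine (C, vC) up to isometric isomorphism. *)
Definition is_Cp (R : realType) (p : nat) (C : fieldType) (vC : abs_value R C)
    : Prop :=
  exists (Qp : fieldType) (vQp : abs_value R Qp) (i0 : {rmorphism rat -> Qp})
         (Qpbar : closedFieldType) (vQpbar : abs_value R Qpbar)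
         (i1 : {rmorphism Qp -> Qpbar}) (i2 : {rmorphism Qpbar -> C}),
  [/\ is_completion (@padic_abs R p) vQp i0,
      forall x : Qpbar, algebraicOver i1 x,
      forall x : Qp, vQpbar (i1 x) = vQp x
    & is_completion vQpbar vC i2].

(* A function on the integers k >= ps_start; the values of ps_fun below
   ps_start carry no meaning. *)
Record path_seq := PathSeq {
  ps_start : nat;
  ps_fun :> nat -> nat;
  ps_start_gt0 : (0 < ps_start)%N;
  ps_gt0 : forall k, (ps_start <= k)%N -> (0 < ps_fun k)%N;
  ps_incr : forall j k, (ps_start <= j)%N -> (j < k)%N ->
    (ps_fun j < ps_fun k)%N
}.

(* The tail psi(k), k >= k0, is a subsequence of phi. *)
Definition tail_subseq (k0 : nat) (psi phi : path_seq) : Prop :=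
  exists s : nat -> nat,
    (forall j k, (k0 <= j)%N -> (j < k)%N -> (s j < s k)%N) /\
    (forall k, (k0 <= k)%N -> (ps_start phi <= s k)%N /\ psi k = phi (s k)).

Definition interlocked (Phi : set path_seq) : Prop :=
  Phi !=set0 /\
  forall phi1 phi2, Phi phi1 -> Phi phi2 ->
    exists phi3 k0, [/\ Phi phi3, (ps_start phi3 <= k0)%N,
      tail_subseq k0 phi3 phi1 & tail_subseq k0 phi3 phi2].

Record interlocked_family := InterlockedFamily {
  family_set : set path_seq;
  family_interlocked : interlocked family_set
}.

Definition Phi_set (alpha : int) : set path_seq :=
  [set phi | exists lambda : nat, (0 < lambda)%N /\
     forall k : nat, (ps_start phi <= k)%N ->
       (phi k)%:Z = alpha + (lambda * k)%N%:Z].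

Lemma affine_path_seq (alpha : int) (lambda : nat) : (0 < lambda)%N ->
  exists phi : path_seq, forall k : nat, (ps_start phi <= k)%N ->
    (phi k)%:Z = alpha + (lambda * k)%N%:Z.
Proof.
move=> l0; pose f k := `|(alpha + (lambda * k)%N%:Z)%R|%N.
have key k : (`|alpha|%N.+1 <= k)%N -> 0 < alpha + (lambda * k)%N%:Z.
  move=> hk; have hk' : (`|alpha|%N < lambda * k)%N.
    by exact: leq_trans hk (leq_pmull _ l0).
  have : - alpha < (lambda * k)%N%:Z.
    rewrite (le_lt_trans (ler_norm _))// normrN -abszE.
    by rewrite ltz_nat.
  by rewrite -subr_gt0 opprK addrC.
have fE k : (`|alpha|%N.+1 <= k)%N -> (f k)%:Z = alpha + (lambda * k)%N%:Z.
  by move=> hk; rewrite /f gez0_abs// ltW// key.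
have h1 k : (`|alpha|%N.+1 <= k)%N -> (0 < f k)%N.
  by move=> hk; rewrite -ltz_nat fE// key.
have h2 j k : (`|alpha|%N.+1 <= j)%N -> (j < k)%N -> (f j < f k)%N.
  move=> hj jk; have hk := leq_trans hj (ltnW jk).
  rewrite -ltz_nat (fE _ hj) (fE _ hk).
  by rewrite ltrD2l ltz_nat ltn_pmul2l.
by exists (PathSeq (ltn0Sn _) h1 h2) => k /= /fE.
Qed.

Lemma Phi_interlocked (alpha : int) : interlocked (Phi_set alpha).
Proof.
split.
  by have [phi hphi] := affine_path_seq alpha (ltn0Sn 0); exists phi, 1%N.
move=> phi1 phi2 [l1 [l1_gt0 h1]] [l2 [l2_gt0 h2]].
have l12 : (0 < l1 * l2)%N by rewrite muln_gt0 l1_gt0.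
have [phi3 h3] := affine_path_seq alpha l12.
exists phi3, (ps_start phi3 + (ps_start phi1 + ps_start phi2))%N; split.
- by exists (l1 * l2)%N.
- exact: leq_addr.
- exists (fun k => l2 * k)%N; split=> [j k _ jk|k hk].
    by rewrite ltn_pmul2l.
  have hs : (ps_start phi1 <= l2 * k)%N.
    apply: leq_trans (leq_pmull _ l2_gt0); apply: leq_trans hk.
    by rewrite addnCA leq_addr.
  split=> //; have [] // : (phi3 k)%:Z = (phi1 (l2 * k)%N)%:Z.
  by rewrite h1// h3 ?mulnA//; apply: leq_trans hk; exact: leq_addr.
- exists (fun k => l1 * k)%N; split=> [j k _ jk|k hk].
    by rewrite ltn_pmul2l.
  have hs : (ps_start phi2 <= l1 * k)%N.
    apply: leq_trans (leq_pmull _ l1_gt0); apply: leq_trans hk.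
    by rewrite addnA leq_addl.
  split=> //; have [] // : (phi3 k)%:Z = (phi2 (l1 * k)%N)%:Z.
  rewrite h2// h3; first by rewrite mulnA (mulnC l2).
  by apply: leq_trans hk; exact: leq_addr.
Qed.

Definition Phi (alpha : int) : interlocked_family :=
  InterlockedFamily (Phi_interlocked alpha).

Section Integral.
Variables (R : realType) (p : nat) (C : fieldType) (v : abs_value R C).

Definition arc_mean (a b : C) (f : C -> C) (phi : path_seq) (k : nat) : C :=
  ((p ^ phi k)%N%:R)^-1 *
  \sum_(zeta \in [set zeta : C | (p ^ phi k)%N.-unity_root zeta])
     (let x := a + (b - a) * zeta in (x - a) * f x).

Definition arc_has_integral (a b : C) (F : interlocked_family) (f : C -> C)
    (L : C) : Prop :=
  forall eps : R, 0 < eps ->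
    exists (phi : path_seq) (K : nat), family_set F phi /\
      forall k : nat, (ps_start phi <= k)%N -> (K < k)%N ->
        v (arc_mean a b f phi k - L) < eps.

Definition arc_integrable (a b : C) (F : interlocked_family) (f : C -> C)
    : Prop :=
  exists L : C, arc_has_integral a b F f L.

(* Meaningful only when arc_integrable holds; 0 otherwise. *)
Definition arc_integral (a b : C) (F : interlocked_family) (f : C -> C) : C :=
  xget 0 [set L | arc_has_integral a b F f L].

(* Meaningful only for v x <= 1. *)
Definition teichmuller (x : C) : C :=
  if v x < 1 then 0
  else xget 0 [set w : C | (exists n : nat, coprime n p /\ n.-primitive_root w)
                           /\ v (x - w) < 1].

End Integral.

(* Main.v *)
Require Import Defs.
From HB Require Import structures.
From mathcomp Require Import all_boot all_order all_algebra.
From mathcomp Require Import all_classical all_reals all_analysis.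
From mathcomp Require Import all_solvable all_field.
From mathcomp Require Import zify ring.

Set Implicit Arguments.
Unset Strict Implicit.
Unset Printing Implicit Defensive.

Import Order.TTheory GRing.Theory Num.Theory.
Import numFieldNormedType.Exports.

Local Open Scope classical_set_scope.
Local Open Scope ring_scope.

(** Put [t = (z - a) / (b - a)], so that [|t| <= 1] and [|t - 1| = 1], and
    [n = p ^ phi k].  Averaged over the [n]-th roots of unity [w],
    [w * w ^ i / (w - t)] gives exactly [t ^ (i mod n) / (1 - t ^ n)], where
    [|1 - t ^ n| = 1].  Writing [f] as a power series with coefficients tending
    to [0], the arc mean is therefore as close as we like to
    [f z / (1 - t ^ n)]: only the terms of index [i >= n] contribute an error.
    The residue of [t] is algebraic over the prime field, hence fixed by the
    [l]-th iterate of Frobenius for some [l]; then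
    [t ^ (p ^ (alpha + l * k))] tends to [omega t ^ (p ^ alpha)], because
    [x |-> x ^ p] contracts residue discs.  *)

Lemma expr_lt_eps (R : realType) (rho eps : R) : 0 <= rho < 1 -> 0 < eps ->
  exists N : nat, forall n, (N <= n)%N -> rho ^+ n < eps.
Proof.
move=> /andP[rho0 rho1] eps0.
have /cvgrPdist_lt /(_ _ eps0) [N _ hN] :
    (GRing.exp rho : R ^nat) x @[x --> \oo] --> (0 : R).
  by apply: cvg_expr; rewrite ger0_norm.
exists N => n Nn; have := hN n Nn.
by rewrite /= sub0r normrN ger0_norm // exprn_ge0.
Qed.

(** * Elementary estimates for an ultrametric absolute value *)

Section Ultrametric.
Variables (R : realType) (K : fieldType) (v : abs_value R K).
Implicit Types (x y d : K) (B : R).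

Lemma abs0 : v 0 = 0.
Proof. exact/abs_eq0. Qed.

Lemma abs_gt0 x : x != 0 -> 0 < v x.
Proof.
move=> x0; rewrite lt_neqAle abs_ge0 andbT; apply/eqP => e.
by move/eqP: x0; apply; apply/(abs_eq0 v).
Qed.

Lemma abs1 : v 1 = 1.
Proof.
have /mulfI : v 1 != 0 by rewrite gt_eqF // abs_gt0 // oner_neq0.
by apply; rewrite -absM !mulr1.
Qed.

Lemma absX x n : v (x ^+ n) = v x ^+ n.
Proof.
by elim: n => [|n IH]; rewrite ?expr0 ?abs1 // !exprS absM IH.
Qed.

Lemma absN x : v (- x) = v x.
Proof.
have vN1 : v (-1) = 1.
  apply/eqP; rewrite -(@pexpr_eq1 _ _ 2) ?abs_ge0 //.
  by rewrite -absX sqrrN expr1n abs1.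
by rewrite -mulN1r absM vN1 mul1r.
Qed.

Lemma absBC x y : v (x - y) = v (y - x).
Proof. by rewrite -opprB absN. Qed.

Lemma absV x : v x^-1 = (v x)^-1.
Proof.
have [->|x0] := eqVneq x 0; first by rewrite invr0 abs0 invr0.
have vx0 : v x != 0 by rewrite gt_eqF // abs_gt0.
by apply: (mulfI vx0); rewrite -absM !divff // abs1.
Qed.

Lemma absD_le B x y : v x <= B -> v y <= B -> v (x + y) <= B.
Proof.
by move=> xB yB; apply: le_trans (abs_ultra v x y) _; rewrite ge_max xB.
Qed.

Lemma absD_lt B x y : v x < B -> v y < B -> v (x + y) < B.
Proof.
by move=> xB yB; apply: le_lt_trans (abs_ultra v x y) _; rewrite gt_max xB.
Qed.

Lemma absB_le B x y : v x <= B -> v y <= B -> v (x - y) <= B.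
Proof. by move=> ? ?; apply: absD_le => //; rewrite absN. Qed.

Lemma absB_lt B x y : v x < B -> v y < B -> v (x - y) < B.
Proof. by move=> ? ?; apply: absD_lt => //; rewrite absN. Qed.

Lemma abs_trans_lt B x y d : v (x - y) < B -> v (y - d) < B -> v (x - d) < B.
Proof. by move=> h1 h2; rewrite -(subrK y x) -addrA; apply: absD_lt. Qed.

Lemma abs_sum_le (I : Type) (s : seq I) (P : pred I) (F : I -> K) B : 0 <= B ->
  (forall i, P i -> v (F i) <= B) -> v (\sum_(i <- s | P i) F i) <= B.
Proof.
move=> B0 FB; elim/big_rec: _ => [|i x Pi xB]; first by rewrite abs0.
by apply: absD_le => //; exact: FB.
Qed.

Lemma abs_sum_lt (I : Type) (s : seq I) (P : pred I) (F : I -> K) B : 0 < B ->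
  (forall i, P i -> v (F i) < B) -> v (\sum_(i <- s | P i) F i) < B.
Proof.
move=> B0 FB; elim/big_rec: _ => [|i x Pi xB]; first by rewrite abs0.
by apply: absD_lt => //; exact: FB.
Qed.

Lemma abs_nat_le1 n : v n%:R <= 1.
Proof.
elim: n => [|n IH]; first by rewrite abs0 ler01.
by rewrite -addn1 natrD; apply: absD_le => //; rewrite abs1.
Qed.

Lemma absM_le1 x y : v x <= 1 -> v y <= 1 -> v (x * y) <= 1.
Proof. by move=> hx hy; rewrite absM mulr_ile1 ?abs_ge0. Qed.

Lemma absM_lt1 x y : v x <= 1 -> v y < 1 -> v (x * y) < 1.
Proof.
by move=> hx; apply: le_lt_trans; rewrite absM ler_piMl ?abs_ge0.
Qed.

Lemma absX_le1 x n : v x <= 1 -> v (x ^+ n) <= 1.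
Proof. by move=> hx; rewrite absX exprn_ile1 ?abs_ge0. Qed.

Lemma absX_lt1 x n : (0 < n)%N -> (v (x ^+ n) < 1) = (v x < 1).
Proof. by move=> n0; rewrite absX expr_lt1 ?abs_ge0. Qed.

Lemma abs_unity_root n x : (0 < n)%N -> x ^+ n = 1 -> v x = 1.
Proof.
move=> n0 xn; apply/eqP.
by rewrite -(@pexpr_eq1 _ _ n) ?abs_ge0 // -absX xn abs1.
Qed.

End Ultrametric.

(** * The [p]-th power map on residue discs *)

Section ResidueCharacteristic.
Variables (R : realType) (K : fieldType) (v : abs_value R K) (p : nat).
Hypotheses (p_prime : prime p) (vp_lt1 : v p%:R < 1).
Implicit Types (x y d w : K).

(** If both [n] and [p] had absolute value below 1, the Bezout relation [1 = b p - a n] would give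
    [v 1 < 1]. *)
Lemma abs_nat_eq1 n : ~~ (p %| n)%N -> v n%:R = 1.
Proof.
move=> pn; have p0 := prime_gt0 p_prime.
have [a _ /dvdnP[b]] := Bezoutl n p0.
have -> : gcdn p n = 1%N by apply/eqP; rewrite -/(coprime _ _) prime_coprime.
move=> e; apply/eqP; rewrite eq_le abs_nat_le1 /= leNgt; apply/negP => vn.
have : v (1 : K) < 1.
  have -> : (1 : K) = b%:R * p%:R - a%:R * n%:R.
    by rewrite -!natrM -e natrD addrK.
  by apply: absB_lt; apply: absM_lt1 => //; exact: abs_nat_le1.
by rewrite abs1 ltxx.
Qed.

(** The middle binomial coefficients are divisible by [p], and every middle term contains a factor
    [d]. Keeping that factor is what makes [x |-> x ^ p] contract distances below. *)
Lemma exprD_prime y d : v y <= 1 -> v d <= 1 ->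
  exists2 e : K, v e <= 1 & (y + d) ^+ p = y ^+ p + d ^+ p + p%:R * d * e.
Proof.
move=> vy vd; have [m pE] : exists m, p = m.+2.
  by case: p p_prime => [|[|m]] // _; exists m.
exists (\sum_(i < m.+1) y ^+ (p - i.+1) * d ^+ i * ('C(p, i.+1) %/ p)%N%:R).
  apply: abs_sum_le => // i _; apply: absM_le1 (abs_nat_le1 _ _).
  by apply: absM_le1; apply: absX_le1.
have bE (i : 'I_m.+1) : 'C(p, i.+1) = (p * ('C(p, i.+1) %/ p))%N.
  rewrite mulnC divnK // prime_dvd_bin //= pE ltnS; exact: ltn_ord.
rewrite exprDn pE big_ord_recl big_ord_recr /= -pE.
rewrite subn0 expr0 mulr1 bin0 mulr1n /bump /= add1n -pE subnn expr0 mul1r.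
rewrite binn mulr1n -addrA; congr (_ + _); rewrite addrC; congr (_ + _).
rewrite mulr_sumr; apply: eq_bigr => i _; rewrite /= add1n.
rewrite {1}bE -mulr_natr natrM exprS; ring.
Qed.

(** With [d = x - y] the difference of powers is [d ^ p + p d e]. The first term gains a factor
    [rho] because [p >= 2] and [v d <= rho], the second because [v p <= rho]. *)
Lemma abs_expr_primeB rho x y : v x <= 1 -> v y <= 1 -> v p%:R <= rho ->
  v (x - y) <= rho -> v (x ^+ p - y ^+ p) <= rho * v (x - y).
Proof.
move=> vx vy hp hxy; have vd : v (x - y) <= 1 by apply: absB_le.
have rho0 : 0 <= rho by apply: le_trans hp; rewrite abs_ge0.
have [e ve] := exprD_prime vy vd; rewrite subrKC => ->.
rewrite [X in v X <= _](_ : _ =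
  (x - y) ^+ p + p%:R * (x - y) * e); last by ring.
apply: absD_le; last first.
  rewrite !absM.
  apply: le_trans (_ : rho * v (x - y) * 1 <= _); last by rewrite mulr1.
  by rewrite ler_pM ?mulr_ge0 ?abs_ge0 // ler_wpM2r ?abs_ge0.
have [m ->] : exists m, p = m.+2.
  by case: p p_prime => [|[|m]] // _; exists m.
rewrite exprSr absM ler_wpM2r ?abs_ge0 //.
by rewrite exprSr absM (le_trans _ hxy) // ler_piMl ?abs_ge0 // absX_le1.
Qed.

Lemma abs_expr_prime_powB rho x y k : v x <= 1 -> v y <= 1 ->
  v p%:R <= rho -> v (x - y) <= rho -> rho <= 1 ->
  v (x ^+ (p ^ k) - y ^+ (p ^ k)) <= rho ^+ k.+1.
Proof.
move=> vx vy hp hxy rho1; have rho0 := le_trans (abs_ge0 v _) hp.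
elim: k => [|k IH]; first by rewrite expn0 !expr1.
rewrite expnSr !exprM exprS.
apply: le_trans (abs_expr_primeB (rho := rho) _ _ _ _) _ => //.
- exact: absX_le1.
- exact: absX_le1.
- by apply: le_trans IH _; rewrite exprS ler_piMr // exprn_ile1.
- by rewrite ler_wpM2l.
Qed.

Lemma cvg_expr_prime_powB x y (eps : R) : v x <= 1 -> v y <= 1 ->
  v (x - y) < 1 -> 0 < eps -> exists N : nat, forall k, (N <= k)%N ->
  v (x ^+ (p ^ k) - y ^+ (p ^ k)) < eps.
Proof.
(* The smallest ratio that dominates both [v p] and the initial distance; it is still below 1. *)
move=> vx vy vxy eps0; pose rho := Num.max (v p%:R) (v (x - y)).
have rho1 : rho < 1 by rewrite gt_max vp_lt1.
have hp : v p%:R <= rho by rewrite le_max lexx.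
have hxy : v (x - y) <= rho by rewrite le_max lexx orbT.
have rho0 : 0 <= rho by rewrite (le_trans _ hp) // abs_ge0.
have [|N hN] := @expr_lt_eps R rho eps _ eps0; first by rewrite rho0.
exists N => k Nk.
apply: le_lt_trans (abs_expr_prime_powB k vx vy hp hxy (ltW rho1)) _.
by apply: hN; rewrite (leq_trans Nk).
Qed.

(** Injectivity of Frobenius on the residue field: [x ^ p - y ^ p] and [(x - y) ^ p] differ by a
    multiple of [p]. *)
Lemma abs_expr_prime_powB_lt1 x y k : v x <= 1 -> v y <= 1 ->
  (v (x ^+ (p ^ k) - y ^+ (p ^ k)) < 1) = (v (x - y) < 1).
Proof.
move=> vx vy; elim: k => [|k IH]; first by rewrite expn0 !expr1.
rewrite -IH expnSr !exprM.
have := absX_le1 (p ^ k) vx; have := absX_le1 (p ^ k) vy.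
move: (x ^+ _) (y ^+ _) => {IH vx vy} {}x {}y vy vx.
have vd : v (x - y) <= 1 by apply: absB_le.
rewrite -[RHS](absX_lt1 _ _ (prime_gt0 p_prime)).
have [e ve] := exprD_prime vy vd; rewrite subrKC => ->.
have ve1 : v (p%:R * (x - y) * e) < 1.
  by rewrite -mulrA mulrC; apply: absM_lt1 => //; exact: absM_le1.
have -> : y ^+ p + (x - y) ^+ p + p%:R * (x - y) * e - y ^+ p =
  (x - y) ^+ p + p%:R * (x - y) * e by ring.
apply/idP/idP => h; last exact: absD_lt.
by rewrite -[_ ^+ p](addrK (p%:R * (x - y) * e)); apply: absB_lt.
Qed.

(** Raising to the power [p ^ (l * N)] changes neither point, yet it brings points of one residue
    disc arbitrarily close. *)
Lemma eq_of_frobenius_fixed l w w' : (0 < l)%N -> v w <= 1 -> v w' <= 1 ->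
  w ^+ (p ^ l) = w -> w' ^+ (p ^ l) = w' -> v (w - w') < 1 -> w = w'.
Proof.
move=> l0 vw vw' wl wl' ww'; apply/eqP; rewrite -subr_eq0.
apply/negPn/negP => /(abs_gt0 v) h.
have [N /(_ (l * N)%N)] := cvg_expr_prime_powB vw vw' ww' h.
have fixE (u : K) : u ^+ (p ^ l) = u -> u ^+ (p ^ (l * N)) = u.
  move=> ul; elim: N => [|N IH]; first by rewrite muln0 expn0 expr1.
  by rewrite mulnS expnD exprM ul.
by rewrite !fixE // ltxx leq_pmull // => /(_ isT).
Qed.

Lemma frobenius_fixed_unity_root n w : coprime n p -> w ^+ n = 1 ->
  w ^+ (p ^ totient n) = w.
Proof.
move=> np wn; have n0 : (0 < n)%N.
  by case: n np {wn} => // /eqP; rewrite gcd0n => e; move: p_prime; rewrite e.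
have := Euler_exp_totient (n := n) (a := p); rewrite coprime_sym np => /(_ isT).
(* By Euler, [p ^ totient n] is 1 modulo [n]; the case [n = 1] is separate because there the
   remainder is 0. *)
move=> e; rewrite (divn_eq (p ^ totient n) n) e exprD.
rewrite mulnC exprM wn expr1n mul1r.
have [n1|n1] := ltnP 1 n; first by rewrite modn_small.
have -> : w = 1 by move: wn; rewrite (_ : n = 1%N) ?expr1 //; lia.
by rewrite expr1n.
Qed.

(** Uniqueness of the Teichmuller representative: both roots of unity are fixed by the Frobenius
    iterate of index [totient (n * n')]. *)
Lemma eq_of_unity_roots n n' w w' : coprime n p -> coprime n' p ->
  w ^+ n = 1 -> w' ^+ n' = 1 -> v (w - w') < 1 -> w = w'.
Proof.
move=> np np' wn wn'.
have gt0 m : coprime m p -> (0 < m)%N.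
  by case: m => // /eqP; rewrite gcd0n => e; move: p_prime; rewrite e.
have NN : coprime (n * n') p by rewrite coprimeMl np.
apply: (@eq_of_frobenius_fixed (totient (n * n'))).
- by rewrite totient_gt0 gt0.
- by rewrite (abs_unity_root v (gt0 _ np) wn).
- by rewrite (abs_unity_root v (gt0 _ np') wn').
- by apply: frobenius_fixed_unity_root; rewrite // exprM wn expr1n.
- by apply: frobenius_fixed_unity_root; rewrite // mulnC exprM wn' expr1n.
Qed.

End ResidueCharacteristic.

(** * Sums over the roots of unity *)

Lemma closed_Xn_sub_1_split (F : closedFieldType) n : n%:R != 0 :> F ->
  exists2 rs : seq F, uniq rs & 'X^n - 1 = \prod_(w <- rs) ('X - w%:P).
Proof.
move=> n0; have [rs rsE] := closed_field_poly_normal ('X^n - 1 : {poly F}).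
have n_gt0 : (0 < n)%N by case: n n0 {rsE} => //; rewrite eqxx.
rewrite lead_coefXnsubC // scale1r in rsE.
by exists rs => //; rewrite -separable_prod_XsubC -rsE separable_Xn_sub_1.
Qed.

Section UnityRoots.
Variables (F : fieldType) (n : nat) (rs : seq F).
Hypotheses (n_gt0 : (0 < n)%N) (rs_uniq : uniq rs).
Hypothesis rsE : 'X^n - 1 = \prod_(w <- rs) ('X - w%:P).

Lemma mem_roots_XnsubC1 w : (w \in rs) = (w ^+ n == 1).
Proof.
by rewrite -root_prod_XsubC -rsE rootE !hornerE subr_eq0.
Qed.

Lemma size_roots_XnsubC1 : size rs = n.
Proof.
apply: succn_inj; rewrite -(size_prod_XsubC rs id) -rsE size_XnsubC //.
Qed.

(** When [n] does not divide [m], multiplication by a primitive root [e] permutes the roots and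
    multiplies the sum by [e ^ m != 1], so the sum vanishes. *)
Lemma sum_unity_roots_exp m :
  \sum_(w <- rs) w ^+ m = if (n %| m)%N then n%:R else 0.
Proof.
have /hasP[e e_rs e_prim] : has n.-primitive_root rs.
  apply: has_prim_root; rewrite ?size_roots_XnsubC1 //.
  by apply/allP => w; rewrite mem_roots_XnsubC1 unity_rootE.
case: ifP => nm.
  have /dvdnP[k ->] := nm.
  rewrite big_seq (eq_bigr (fun=> 1)) -?big_seq ?big_const_seq.
    by rewrite count_predT iter_addr_0 size_roots_XnsubC1.
  by move=> w; rewrite mem_roots_XnsubC1 mulnC exprM => /eqP ->; rewrite expr1n.
have e_m1 : e ^+ m != 1 by rewrite -(prim_order_dvd e_prim) nm.
have en := prim_expr_order e_prim.
have e0 : e != 0.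
  by apply: contra_eq_neq en => ->; rewrite expr0n gtn_eqF // eq_sym oner_neq0.
have permE : perm_eq rs [seq e * w | w <- rs].
  apply: uniq_perm => //; first by rewrite map_inj_uniq //; exact: mulfI.
  move=> w; rewrite mem_roots_XnsubC1; apply/eqP/mapP => [wn|[u + ->]].
    exists (e^-1 * w); last by rewrite mulVKf.
    by rewrite mem_roots_XnsubC1 exprMn exprVn en wn invr1 mulr1.
  by rewrite mem_roots_XnsubC1 exprMn en mul1r => /eqP.
apply/eqP; rewrite -[_ == 0]orFb -(negbTE e_m1) -subr_eq0 -mulf_eq0.
rewrite mulrBl mul1r subr_eq0 mulr_sumr.
rewrite [X in _ == X](perm_big _ permE) /= big_map.
by apply/eqP; apply: eq_bigr => w _; rewrite exprMn.
Qed.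

(** Since [1 - t ^ n = w ^ n - t ^ n], multiplying by it turns the kernel [1 / (w - t)] into a
    geometric sum in [w]. Orthogonality of the roots then keeps the single term [j = i mod n]. *)
Lemma sum_unity_roots_kernel i t : t ^+ n != 1 ->
  \sum_(w <- rs) w * (w ^+ i / (w - t)) = n%:R * (t ^+ (i %% n) / (1 - t ^+ n)).
Proof.
move=> tn; have tn0 : 1 - t ^+ n != 0 by rewrite subr_eq0 eq_sym.
rewrite mulrA; apply: (canRL (mulfK tn0)).
have step w : w \in rs -> w * (w ^+ i / (w - t)) * (1 - t ^+ n) =
    \sum_(j < n) t ^+ j * w ^+ (i + (n - j)).
  rewrite mem_roots_XnsubC1 => /eqP wn.
  have wt : w - t != 0.
    by rewrite subr_eq0; apply: contra_neq tn => <-.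
  rewrite -{1}wn subrXX.
  rewrite [LHS](_ : _ = w ^+ i.+1 * \sum_(j < n) w ^+ (n.-1 - j) * t ^+ j).
    rewrite mulr_sumr; apply: eq_bigr => j _.
    rewrite mulrA -exprD mulrC; congr (_ * _ ^+ _).
    have := ltn_ord j; lia.
  by rewrite exprS; field.
rewrite mulr_suml big_seq (eq_bigr _ step) -big_seq exchange_big /=.
under eq_bigr => j _ do rewrite -mulr_sumr sum_unity_roots_exp.
have i_lt := ltn_pmod i n_gt0.
rewrite (bigD1 (Ordinal i_lt)) //= big1 => [|j jN].
  rewrite (_ : _ %| _)%N ?addr0 1?mulrC //.
  rewrite {1}(divn_eq i n) -addnA subnKC ?(ltnW i_lt) //.
  by rewrite dvdn_addr // dvdn_mull.
case: ifP => [|_]; last by rewrite mulr0.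
have jn := ltn_ord j.
rewrite {1}(divn_eq i n) -addnA dvdn_addr ?dvdn_mull // => /dvdnP[k hk].
case/eqP: jN; apply: val_inj => /=.
(* Here [i mod n + (n - j)] lies strictly between 0 and [2 n], so it can only be [n], which forces
   [j = i mod n]. *)
have : k = 1%N by nia.
by move=> k1; rewrite k1 in hk; lia.
Qed.

End UnityRoots.

(** * Means of a power series against the kernel [w / (w - t)] *)

Section SeriesMean.
Variables (R : realType) (K : fieldType) (v : abs_value R K).
Variables (c : nat -> K) (g : K -> K).
Hypothesis c_cvg0 : forall eps : R, 0 < eps ->
  exists N : nat, forall i, (N <= i)%N -> v (c i) < eps.
Hypothesis gE : forall y, v y <= 1 ->
  abs_cvg v (fun m => \sum_(i < m) c i * y ^+ i) (g y).

Lemma abs_cvg_lt (u : nat -> K) l (eps : R) : abs_cvg v u l -> 0 < eps ->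
  exists N : nat, forall n, (N <= n)%N -> v (u n - l) < eps.
Proof.
move=> /cvgrPdist_lt ul /ul [N _ hN].
exists N => n Nn; have := hN n Nn.
by rewrite /= sub0r normrN ger0_norm // abs_ge0.
Qed.

Lemma abs_series_tail_lt (eps : R) N y : 0 < eps -> v y <= 1 ->
  (forall i, (N <= i)%N -> v (c i) < eps) ->
  v (g y - \sum_(i < N) c i * y ^+ i) < eps.
Proof.
move=> eps0 vy hN; have [M /(_ (M + N)%N (leq_addr _ _))] :=
  abs_cvg_lt (gE vy) eps0.
rewrite absBC => h; apply: (abs_trans_lt h).
rewrite addnC big_split_ord /= addrAC subrr add0r.
apply: abs_sum_lt => // i _.
by rewrite mulrC; apply: le_lt_trans (hN (N + i)%N (leq_addr _ _));
  rewrite absM ler_piMl ?abs_ge0 // absX_le1.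
Qed.

(** The factor [1 / n] may be large, so [g] is first replaced by a partial sum accurate to
    [eps * v n]. On that polynomial the kernel identity is exact and cancels [1 / n], which leaves
    the error [(t ^ (i mod n) - t ^ i) * c i / (1 - t ^ n)] for each index. *)
Lemma abs_unity_mean_lt n (rs : seq K) t (eps : R) N : (0 < n)%N ->
  n%:R != 0 :> K -> uniq rs -> 'X^n - 1 = \prod_(w <- rs) ('X - w%:P) ->
  v t <= 1 -> v (1 - t ^+ n) = 1 -> 0 < eps ->
  (forall i, (N <= i)%N -> v (c i) < eps) -> (N <= n)%N ->
  v (n%:R^-1 * \sum_(w <- rs) w * (g w / (w - t)) - g t / (1 - t ^+ n)) < eps.
Proof.
move=> n_gt0 n0 rs_uniq rsE vt vtn eps0 hN Nn.
have vn0 := abs_gt0 v n0.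
have tn : t ^+ n != 1.
  apply: contra_eq_neq vtn => ->.
  by rewrite subrr abs0 eq_sym oner_neq0.
have vw w : w \in rs -> v w = 1.
  by rewrite (mem_roots_XnsubC1 rsE) => /eqP; apply: abs_unity_root.
(* [w - t] divides [w ^ n - t ^ n = 1 - t ^ n] with a quotient of absolute value at most 1, so it
   cannot be smaller than 1. *)
have vwt w : w \in rs -> v (w - t) = 1.
  move=> w_rs; apply/eqP; rewrite eq_le absB_le ?(vw _ w_rs) //=.
  rewrite leNgt; apply/negP => h.
  move: w_rs (vw _ w_rs); rewrite (mem_roots_XnsubC1 rsE) => /eqP wn w1.
  move: vtn; rewrite -{1}wn subrXX mulrC => e.
  have : v (1 : K) < 1.
    rewrite abs1 -{1}e; apply: absM_lt1 => //; apply: abs_sum_le => // i _.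
    by apply: absM_le1; apply: absX_le1 => //; rewrite w1.
  by rewrite abs1 ltxx.
(* The truncation order [m] depends on [n]; this is harmless, because the final bound involves only
   [N]. *)
have [m hm0] := c_cvg0 (mulr_gt0 eps0 vn0).
pose h y := \sum_(i < m) c i * y ^+ i.
have hm y : v y <= 1 -> v (g y - h y) < eps * v n%:R.
  by move=> vy; apply: abs_series_tail_lt => //; rewrite mulr_gt0.
have -> : n%:R^-1 * \sum_(w <- rs) w * (g w / (w - t)) - g t / (1 - t ^+ n) =
  n%:R^-1 * \sum_(w <- rs) w * ((g w - h w) / (w - t))
  - (g t - h t) / (1 - t ^+ n)
  + (n%:R^-1 * \sum_(w <- rs) w * (h w / (w - t)) - h t / (1 - t ^+ n)).
  have -> : \sum_(w <- rs) w * ((g w - h w) / (w - t)) =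
     \sum_(w <- rs) w * (g w / (w - t)) - \sum_(w <- rs) w * (h w / (w - t)).
    by rewrite -sumrB; apply: eq_bigr => w _; rewrite -mulrBr mulrBl.
  by rewrite mulrBl mulrBr; ring.
apply: absD_lt; first apply: absB_lt.
- rewrite absM absV mulrC ltr_pdivrMr //.
  rewrite big_seq; apply: abs_sum_lt => [|w w_rs]; first exact: mulr_gt0.
  rewrite !absM vw // mul1r absV vwt // invr1 mulr1.
  by apply: hm; rewrite vw.
- rewrite absM absV vtn invr1 mulr1; apply: lt_le_trans (hm _ vt) _.
  by rewrite ler_piMr ?abs_nat_le1 // ltW.
have -> : \sum_(w <- rs) w * (h w / (w - t)) =
    \sum_(i < m) c i * (n%:R * (t ^+ (i %% n) / (1 - t ^+ n))).
  under [RHS]eq_bigr => i _ do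
    rewrite -(sum_unity_roots_kernel n_gt0 rs_uniq rsE) // mulr_sumr.
  rewrite exchange_big; apply: eq_bigr => w _ /=.
  by rewrite /h mulr_suml mulr_sumr; apply: eq_bigr => i _; ring.
rewrite /h mulr_suml mulr_sumr -sumrB; apply: abs_sum_lt => // i _.
have -> : n%:R^-1 * (c i * (n%:R * (t ^+ (i %% n) / (1 - t ^+ n))))
    - c i * t ^+ i / (1 - t ^+ n) =
    (t ^+ (i %% n) - t ^+ i) * c i / (1 - t ^+ n).
  by field; rewrite n0 subr_eq0 eq_sym tn.
rewrite absM absV vtn invr1 mulr1.
(* Indices below [N <= n] equal their residue modulo [n] and contribute nothing; for the others
   [c i] is small. *)
have [iN|Ni] := ltnP i N.
  by rewrite modn_small ?(leq_trans iN) // subrr mul0r abs0.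
apply: le_lt_trans (hN _ Ni); rewrite absM ler_piMl ?abs_ge0 //.
by apply: absB_le; apply: absX_le1.
Qed.

End SeriesMean.

(** * Residues algebraic over the prime field *)

Section Residue.
Variables (R : realType) (K : fieldType) (v : abs_value R K) (p : nat).
Hypotheses (p_prime : prime p) (vp_lt1 : v p%:R < 1).
Implicit Types (x y : K) (P : {poly K}) (Q : {poly int}).

Lemma abs_int_le1 (n : int) : v n%:~R <= 1.
Proof.
case: n => n; first exact: abs_nat_le1.
by rewrite NegzE mulrNz absN; apply: abs_nat_le1.
Qed.

Lemma abs_int_lt1 (n : int) : (p %| n)%Z -> v n%:~R < 1.
Proof.
case/dvdzP=> m ->; rewrite intrM; apply: absM_lt1; first exact: abs_int_le1.
exact: vp_lt1.
Qed.

Lemma abs_horner_le1 P y : v y <= 1 -> (forall i, v P`_i <= 1) -> v P.[y] <= 1.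
Proof.
move=> vy hP; rewrite horner_coef; apply: abs_sum_le => // i _.
by apply: absM_le1 => //; apply: absX_le1.
Qed.

Lemma abs_horner_lt1 P y : v y <= 1 -> (forall i, v P`_i < 1) -> v P.[y] < 1.
Proof.
move=> vy hP; rewrite horner_coef; apply: abs_sum_lt => // i _.
by rewrite mulrC; apply: absM_lt1 => //; apply: absX_le1.
Qed.

(* The residue of [y] is a root of the reduction of [Q] modulo [p], so its
   powers lie in a finite set: the values of the remainders of 'X^n by [Q],
   read modulo [p]. *)
Lemma frobenius_periodic Q y : Q \is monic -> v y <= 1 ->
  v (map_poly intr Q).[y] < 1 ->
  exists2 l, (0 < l)%N & v (y ^+ (p ^ l) - y) < 1.
Proof.
move=> Qmon vy vQy.
pose rem n := Pdiv.Ring.rmodp 'X^n Q.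
pose val_ (S : {poly int}) : K := (map_poly intr S).[y].
have valE S i : (map_poly intr S : {poly K})`_i = (S`_i)%:~R.
  by rewrite coef_map.
have remP n : v (y ^+ n - val_ (rem n)) < 1.
  rewrite (_ : y ^+ n = val_ 'X^n); last by rewrite /val_ map_polyXn hornerXn.
  rewrite {1}(Pdiv.RingMonic.rdivp_eq Qmon 'X^n).
  rewrite /val_ rmorphD rmorphM hornerD hornerM /= addrK.
  apply: absM_lt1 => //; apply: abs_horner_le1 => // i.
  by rewrite valE abs_int_le1.
pose d := size Q.
(* The remainder modulo [Q] with its coefficients reduced modulo [p]: an element of a finite type
   that determines the residue of [y ^ n]. *)
pose code n : {ffun 'I_d -> 'F_p} := [ffun i : 'I_d => ((rem n)`_i)%:~R].
have codeP m n : code m = code n -> v (y ^+ m - y ^+ n) < 1.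
  move=> mn; apply: abs_trans_lt (remP m) _.
  rewrite absBC; apply: abs_trans_lt (remP n) _.
  rewrite /val_ -hornerN -hornerD -rmorphB.
  apply: abs_horner_lt1 => // i; rewrite valE; apply: abs_int_lt1.
  rewrite (dvdz_pcharf (pchar_Fp p_prime)) coefB rmorphB /= subr_eq0.
  have [id|di] := ltnP i d.
    by have /ffunP/(_ (Ordinal id)) := mn; rewrite !ffunE /= => ->.
  have rem0 k : (rem k)`_i = 0.
    rewrite nth_default // (leq_trans _ di) // ltnW //.
    by rewrite Pdiv.Ring.ltn_rmodp monic_neq0.
  by rewrite !rem0.
pose N := #|{ffun 'I_d -> 'F_p}|.
(* Pigeonhole: [N + 1] exponents [p ^ i] for only [N] codes. *)
have /injectivePn[i [j ij eij]] :
    ~~ injectiveb (fun i : 'I_N.+1 => code (p ^ i)%N).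
  by apply/negP => /injectiveP /leq_card; rewrite card_ord ltnn.
wlog lt_ij : i j ij eij / (i < j)%N.
  move=> H; case: (ltngtP i j) => [lt|lt|e]; first exact: (H i j).
    by apply: (H j i) => //; rewrite eq_sym.
  by move/eqP: ij; case; apply: val_inj.
exists (j - i)%N; first by rewrite subn_gt0.
(* Injectivity of Frobenius removes the first [i] iterations from the coincidence of [y ^ (p ^ i)]
   and [y ^ (p ^ j)]. *)
rewrite -(abs_expr_prime_powB_lt1 p_prime vp_lt1 i) ?absX_le1 //.
by rewrite -exprM -expnD subnK 1?ltnW // absBC; apply: codeP.
Qed.

(** Divide [P] by its coefficient of largest absolute value, the last such one in case of ties.
    Later coefficients then have residue 0, so the reduction is monic of degree [d], and rounding
    the earlier ratios to integers gives [Q]. *)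
Lemma monic_int_approx P y : P != 0 -> root P y -> v y <= 1 ->
  (forall i j, v (P`_i / P`_j) <= 1 ->
    exists n : int, v (P`_i / P`_j - n%:~R) < 1) ->
  exists2 Q, Q \is monic & v (map_poly intr Q).[y] < 1.
Proof.
move=> P0 /rootP Py vy approx.
pose max_at k := (k < size P)%N && [forall j : 'I_(size P), v P`_j <= v P`_k].
have sP : (0 < size P)%N by rewrite size_poly_gt0.
have ex_max : exists k, max_at k.
  have [/= k _ hk] := @arg_maxP _ _ _ (Ordinal sP) predT
    (fun i : 'I_(size P) => v P`_i) isT.
  by exists k; rewrite /max_at ltn_ord /=; apply/forallP => j; apply: hk.
have ub_max k : max_at k -> (k <= size P)%N by case/andP => /ltnW.
have [d /andP[dP /forallP dmax] dlast] := ex_maxnP ex_max ub_max.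
have le_d j : v P`_j <= v P`_d.
  have [jP|Pj] := ltnP j (size P); first exact: (dmax (Ordinal jP)).
  by rewrite (nth_default _ Pj) abs0 abs_ge0.
have lt_d j : (d < j)%N -> v P`_j < v P`_d.
  move=> dj; rewrite ltNge; apply/negP => h.
  have [jP|Pj] := ltnP j (size P); last first.
    move: h; rewrite (nth_default _ Pj) abs0 => h.
    have : v (lead_coef P) <= 0 by exact: le_trans (le_d _) h.
    rewrite -lead_coef_eq0 in P0.
    by rewrite leNgt abs_gt0.
  have /dlast : max_at j.
    by rewrite /max_at jP; apply/forallP => k; apply: le_trans h.
  by rewrite leqNgt dj.
have Pd_gt0 : 0 < v P`_d.
  rewrite -lead_coef_eq0 in P0.
  exact: lt_le_trans (abs_gt0 v P0) (le_d _).
have Pd0 : P`_d != 0 by apply: contraTneq Pd_gt0 => ->; rewrite abs0 ltxx.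
have /choice[n nE] i : exists n : int, v (P`_i / P`_d - n%:~R) < 1.
  by apply: approx; rewrite absM absV ler_pdivrMr // mul1r.
pose Q : {poly int} := 'X^d + \poly_(i < d) n i.
exists Q.
  rewrite monicE /Q lead_coefDl ?lead_coefXn // size_polyXn ltnS.
  exact: size_poly.
(* The subtracted polynomial vanishes at [y], and the difference has all coefficients of absolute
   value below 1. *)
have -> : (map_poly intr Q).[y] = (map_poly intr Q - (P`_d)^-1 *: P).[y] :> K.
  by rewrite hornerD hornerN hornerZ Py mulr0 subr0.
apply: abs_horner_lt1 => // i.
rewrite coefB coef_map coefZ /Q coefD coefXn coef_poly /= mulrC.
case: (ltngtP i d) => [id|di|->].
- by rewrite add0r absBC.
- rewrite addr0 sub0r absN absM absV ltr_pdivrMr // mul1r; exact: lt_d.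
- by rewrite addr0 divff // subrr abs0.
Qed.

(** The denominator of [q] is prime to [p]; replacing its inverse by an integer inverse [m] modulo
    [p] changes [q] by less than 1. *)
Lemma rat_int_approx (i : {rmorphism rat -> K}) (q : rat) :
  (forall u, v (i u) = padic_abs R p u) -> v (i q) <= 1 ->
  exists n : int, v (i q - n%:~R) < 1.
Proof.
move=> iE vq.
have p_gt1 : (1 : R) < p%:R by rewrite ltr1n prime_gt1.
have den_p : ~~ (p %| `|denq q|)%N.
  apply/negP => pd; move: vq; rewrite iE /padic_abs.
  case: eqP => [q0|_]; first by move: pd; rewrite q0 /= dvdn1 => /eqP e;
    move: p_prime; rewrite e.
  have pn : ~~ (p %| `|numq q|)%N.
    apply/negP => pn; have := coprime_num_den q.
    rewrite /coprime => /eqP e.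
    have : (p %| 1)%N by rewrite -e dvdn_gcd pn.
    by rewrite dvdn1 => /eqP e1; move: p_prime; rewrite e1.
  rewrite (lognE p `|numq q|) (negbTE pn) !andbF subr0.
  have d0 : (0 < `|denq q|)%N by rewrite absz_gt0 denq_neq0.
  apply/negP; rewrite -ltNge exprn_egt1 //.
  by rewrite -lt0n logn_gt0 mem_primes p_prime d0.
have [m vm] : exists m : int, v ((denq q)%:~R * m%:~R - 1) < 1.
  have p0 := prime_gt0 p_prime.
  have [a _ /dvdnP[b]] := Bezoutl `|denq q| p0.
  have -> : gcdn p `|denq q| = 1%N.
    by apply/eqP; rewrite -/(coprime _ _) prime_coprime.
  move=> e; exists (- a%:Z).
  have dE : denq q = `|denq q|%N by rewrite gtz0_abs ?denq_gt0.
  rewrite dE -intrM -[1]/(1%:~R) -intrB; apply: abs_int_lt1.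
  apply/dvdzP; exists (- b%:Z).
  by rewrite mulNr -PoszM -e PoszD PoszM; ring.
exists (numq q * m).
have vd : v (denq q)%:~R = 1.
  rewrite -{1}[denq q]gtz0_abs ?denq_gt0 //.
  exact: (abs_nat_eq1 p_prime vp_lt1).
have d0 : (denq q)%:~R != 0 :> K.
  by apply: contra_eq_neq vd => ->; rewrite abs0 eq_sym oner_neq0.
rewrite -{1}(divq_num_den q) fmorph_div !rmorph_int intrM.
have -> : (numq q)%:~R / (denq q)%:~R - (numq q)%:~R * m%:~R =
  - ((numq q)%:~R / (denq q)%:~R * ((denq q)%:~R * m%:~R - 1)) :> K by field.
rewrite absN; apply: absM_lt1 => //.
by rewrite absM absV vd invr1 mulr1 abs_int_le1.
Qed.

Lemma abs_prime_lt1 (i : {rmorphism rat -> K}) :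
  (forall u, v (i u) = padic_abs R p u) -> v p%:R < 1.
Proof.
move=> iE; rewrite -(rmorph_nat i) iE /padic_abs.
have p0 := prime_gt0 p_prime.
rewrite pnatr_eq0 -[p == 0]negbK -lt0n p0 /=.
have -> : (p%:R : rat) = p%:~R by [].
rewrite denq_int numq_int /= logn1 logn_prime // eqxx sub0r.
by rewrite exprN1 invf_lt1 ?ltr0n // ltr1n prime_gt1.
Qed.

End Residue.

(** * Roots of unity and Teichmuller representatives in [Cp] *)

Section CpFacts.
Variables (R : realType) (p : nat) (C : fieldType) (v : abs_value R C).
Hypotheses (p_prime : prime p) (hC : is_Cp p v).

Lemma Cp_abs_prime_lt1 : v p%:R < 1.
Proof.
have [Qp [vQ [i0 [Qb [vb [i1 [i2 [[h0 _ _] _ h1 [h2 _ _]]]]]]]]] := hC.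
apply: (@abs_prime_lt1 _ _ v p p_prime (i2 \o (i1 \o i0))) => x.
by rewrite /= h2 h1 h0.
Qed.

Lemma Cp_natr_neq0 n : (0 < n)%N -> n%:R != 0 :> C.
Proof.
have [Qp [vQ [i0 [Qb [vb [i1 [i2 _]]]]]]] := hC.
move=> n0; rewrite -(rmorph_nat (i2 \o (i1 \o i0))) fmorph_eq0.
by rewrite pnatr_eq0 -lt0n.
Qed.

(** [is_Cp] asserts algebraic closedness of [Qpbar], so the polynomial is split there and its roots
    are carried over by [i2]. *)
Lemma Cp_Xn_sub_1_split n : (0 < n)%N ->
  exists2 rs : seq C, uniq rs & 'X^n - 1 = \prod_(w <- rs) ('X - w%:P).
Proof.
have [Qp [vQ [i0 [Qb [vb [i1 [i2 _]]]]]]] := hC.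
move=> n0; have [|rs rs_uniq rsE] := @closed_Xn_sub_1_split Qb n.
  have := Cp_natr_neq0 n0; apply: contra_neq => n00.
  by rewrite -(rmorph_nat i2) n00 rmorph0.
exists (map i2 rs); first by rewrite map_inj_uniq //; apply: fmorph_inj.
rewrite big_map -map_prod_XsubC -rsE.
by rewrite rmorphB rmorph1 /= map_polyXn.
Qed.

(** By density [t] shares its residue with some [y] algebraic over [Qp]. The relevant ratios of
    coefficients of its equation are rounded first to rationals, then to integers, which reduces the
    claim to a monic integer polynomial. *)
Lemma Cp_frobenius_periodic t : v t <= 1 ->
  exists2 l, (0 < l)%N & v (t ^+ (p ^ l) - t) < 1.
Proof.
have vp := Cp_abs_prime_lt1.
have [Qp [vQ [i0 [Qb [vb [i1 [i2 [hQp alg h1 [h2 _ dense]]]]]]]]] := hC.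
have [h0 _ dense0] := hQp.
move=> vt; have [x vtx] := dense t 1 ltr01.
pose i := i2 \o i1; pose y := i2 x.
have vi u : v (i u) = vQ u by rewrite /= h2 h1.
have vy : v y <= 1.
  by rewrite -[y](subKr t); apply: absB_le => //; apply: ltW.
have [P P0 Px] := alg x.
have [Q Qmon vQy] :
    exists2 Q : {poly int}, Q \is monic & v (map_poly intr Q).[y] < 1.
  apply: (@monic_int_approx _ _ v (map_poly i P)) => //.
  - by rewrite map_poly_eq0.
  - by rewrite /i map_poly_comp /= fmorph_root.
  move=> j k; rewrite !coef_map -fmorph_div; set u := _ / _ => vu.
  have [q vuq] := dense0 u 1 ltr01.
  have vuq' : v (i u - (i \o i0) q) < 1 by rewrite /= -!rmorphB /= h2 h1.
  have [] := @rat_int_approx _ _ v p p_prime vp (i \o i0) q.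
  - by move=> r; rewrite -h0 -vi.
  - by rewrite -[_ q](subKr (i u)); apply: absB_le => //; apply: ltW.
  by move=> n vn; exists n; apply: abs_trans_lt vn.
have [l l0 vl] := frobenius_periodic p_prime vp Qmon vy vQy.
exists l => //.
apply: abs_trans_lt (_ : v (t ^+ (p ^ l) - y ^+ (p ^ l)) < 1) _.
  by rewrite (abs_expr_prime_powB_lt1 p_prime vp).
by apply: abs_trans_lt vl _; rewrite absBC.
Qed.

(** For [v t = 1], periodicity makes [t ^ N - 1] small with [N = p ^ l - 1], which is prime to [p];
    an [N]-th root of unity near [t] is the representative. *)
Lemma teichmullerP t : v t <= 1 ->
  [/\ v (t - teichmuller p v t) < 1, v (teichmuller p v t) <= 1 &
   exists2 l, (0 < l)%N & teichmuller p v t ^+ (p ^ l) = teichmuller p v t].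
Proof.
have vp := Cp_abs_prime_lt1; have p0 := prime_gt0 p_prime.
move=> vt; rewrite /teichmuller; have [t1|t1] := ltP (v t) 1.
  rewrite subr0 abs0 ler01; split=> //; exists 1%N => //.
  by rewrite expn1 expr0n gtn_eqF.
have {}t1 : v t = 1 by apply/eqP; rewrite eq_le vt.
have [l l0 vl] := Cp_frobenius_periodic vt.
pose N := (p ^ l).-1.
have pl : (p ^ l)%N = N.+1 by rewrite prednK // expn_gt0 p0.
have N0 : (0 < N)%N.
  have : (1 < p ^ l)%N by rewrite -(expn0 p) ltn_exp2l ?prime_gt1.
  by rewrite pl.
have vN : v (t ^+ N - 1) < 1.
  have tN : t ^+ (p ^ l) - t = t * (t ^+ N - 1) by rewrite pl exprS; ring.
  by move: vl; rewrite tN absM t1 mul1r.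
have [rs _ rsE] := Cp_Xn_sub_1_split N0.
(* [t ^ N - 1] is the product of the [t - w]; were every factor at least 1 in absolute value, so
   would be the product. *)
have [w w_rs vtw] : exists2 w, w \in rs & v (t - w) < 1.
  apply: contrapT => far.
  have tE : t ^+ N - 1 = \prod_(w <- rs) (t - w).
    transitivity ('X^N - 1 : {poly C}).[t]; first by rewrite !hornerE.
    by rewrite rsE horner_prod; apply: eq_bigr => w _; rewrite !hornerE.
  move: vN; apply/negP; rewrite -leNgt tE big_seq.
  apply: (big_ind (fun x => 1 <= v x)) => [|x y hx hy|w w_rs].
  - by rewrite abs1.
  - by rewrite absM mulr_ege1.
  - by rewrite leNgt; apply/negP => vtw; apply: far; exists w.
have wN : w ^+ N = 1 by move: w_rs; rewrite (mem_roots_XnsubC1 rsE) => /eqP.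
have Np : coprime N p.
  rewrite coprime_sym prime_coprime //; apply/negP => pN.
  have : (p %| N.+1)%N by rewrite -pl dvdn_exp.
  by rewrite -addn1 dvdn_addr // dvdn1 => /eqP e; move: p_prime; rewrite e.
have -> : xget 0 [set w : C | (exists n, coprime n p /\ n.-primitive_root w)
    /\ v (t - w) < 1] = w.
  apply: xget_unique => [|w' [[n [np w'n]] vtw']].
    have [n w_prim nN] := prim_order_exists N0 wN.
    by split=> //; exists n; rewrite (coprime_dvdl nN).
  apply: (eq_of_unity_roots p_prime vp np Np (prim_expr_order w'n) wN).
  by apply: abs_trans_lt vtw; rewrite absBC.
split=> //; first by rewrite (abs_unity_root v N0 wN).
by exists l => //; rewrite pl exprS wN mulr1.
Qed.

End CpFacts.

(** * Uniqueness of the integral *)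

Section IntegralUnique.
Variables (R : realType) (p : nat) (C : fieldType) (v : abs_value R C).

Lemma leq_increasing_from k0 (s : nat -> nat) :
  (forall j k, (k0 <= j)%N -> (j < k)%N -> (s j < s k)%N) ->
  forall n, (n <= s (k0 + n))%N.
Proof.
move=> s_incr; elim=> // n IH; apply: leq_ltn_trans IH _.
by apply: s_incr; rewrite ?leq_addr // addnS.
Qed.

(** A mean depends on the path sequence only through its value, so along a common tail one mean is
    close to both limits. Taking [eps = v (L - L')] gives a contradiction. *)
Lemma arc_has_integral_unique a b (F : interlocked_family) (f : C -> C) L L' :
  arc_has_integral p v a b F f L -> arc_has_integral p v a b F f L' -> L = L'.
Proof.
move=> hL hL'; apply/eqP; rewrite -subr_eq0; apply/negPn/negP => /(abs_gt0 v) h.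
have [phi [K [Fphi hphi]]] := hL _ h.
have [phi' [K' [Fphi' hphi']]] := hL' _ h.
have [_ /(_ _ _ Fphi Fphi')] := family_interlocked F.
move=> [psi [k0 [_ _ [s [s_incr sE]] [s' [s'_incr s'E]]]]].
(* Far enough that both [s k > K] and [s' k > K']. *)
pose k := (k0 + (K + K').+1)%N; have k0k : (k0 <= k)%N by exact: leq_addr.
have [ps_s psi_s] := sE _ k0k; have [ps_s' psi_s'] := s'E _ k0k.
have sK : (K < s k)%N.
  by apply: leq_trans (leq_increasing_from s_incr _); rewrite ltnS leq_addr.
have s'K' : (K' < s' k)%N.
  by apply: leq_trans (leq_increasing_from s'_incr _); rewrite ltnS leq_addl.
have := hphi _ ps_s sK; have := hphi' _ ps_s' s'K'.
rewrite /arc_mean -psi_s -psi_s' => h1; rewrite absBC => h2.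
by have := abs_trans_lt h2 h1; rewrite ltxx.
Qed.

Lemma arc_integral_eq a b (F : interlocked_family) (f : C -> C) L :
  arc_has_integral p v a b F f L -> arc_integral p v a b F f = L.
Proof.
move=> hL; apply: xget_unique => // L' hL'.
exact: arc_has_integral_unique hL.
Qed.

End IntegralUnique.

(** * Evaluation of the arc integral *)

Lemma arc_mean_seq (p : nat) (C : fieldType) (a b : C) (f : C -> C)
    (phi : path_seq) k (rs : seq C) : uniq rs ->
  'X^(p ^ phi k) - 1 = \prod_(w <- rs) ('X - w%:P) ->
  arc_mean p a b f phi k = (p ^ phi k)%N%:R^-1 *
    \sum_(w <- rs) (b - a) * w * f (a + (b - a) * w).
Proof.
move=> rs_uniq rsE; rewrite /arc_mean; congr (_ * _).
rewrite [RHS](fsbig_seq _ _ rs_uniq).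
have -> : [set zeta : C | (p ^ phi k)%N.-unity_root zeta] = [set` rs].
  by apply/seteqP; split=> w /=; rewrite (mem_roots_XnsubC1 rsE) unity_rootE.
by apply: eq_fsbigr => w _ /=; rewrite addrC addKr.
Qed.

Theorem theorem6p7 (R : realType) (p : nat) (p_prime : prime p) (p_odd : odd p)
    (Cp : fieldType) (absp : abs_value R Cp) (hCp : is_Cp p absp)
    (a : Cp) (r : R) (r_gt0 : 0 < r) (f : Cp -> Cp) (hf : HD absp a r f)
    (b : Cp) (hb : absp (b - a) = r)
    (z : Cp) (hz : (closed_disc absp a r `\` open_arc absp a b) z)
    (alpha : nat) :
  arc_integrable p absp a b (Phi alpha%:Z) (fun x => f x / (x - z)) /\
  f z = (1 - teichmuller p absp ((a - z) / (a - b)) ^+ (p ^ alpha)%N)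
        * arc_integral p absp a b (Phi alpha%:Z) (fun x => f x / (x - z)).
Proof.
have vp := Cp_abs_prime_lt1 p_prime hCp; have p0 := prime_gt0 p_prime.
have ba0 : b - a != 0.
  by apply: contraTneq r_gt0 => e; rewrite -hb e abs0 ltxx.
have {r r_gt0 hb hf hz} [u uE [za zb]] : exists2 u : nat -> Cp,
    forall x, absp (x - a) <= absp (b - a) ->
      abs_cvg absp (fun n => \sum_(i < n) u i * (x - a) ^+ i) (f x)
    & absp (z - a) <= absp (b - a) /\ absp (b - a) <= absp (z - b).
  case: hf => u uE; exists u; first by rewrite hb.
  case: hz => za; rewrite /open_arc /= => /negP; rewrite -leNgt => zb.
  by rewrite hb; split=> //; rewrite -hb absBC.
have vba := abs_gt0 absp ba0.
pose t := (z - a) / (b - a).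
have tE : (a - z) / (a - b) = t.
  by rewrite -(opprB z) -(opprB b) invrN mulrNN.
have zE : z = a + (b - a) * t by rewrite /t mulrC divfK // addrC subrK.
have vt : absp t <= 1 by rewrite absM absV ler_pdivrMr // mul1r.
have vt1 : absp (t - 1) = 1.
  apply/eqP; rewrite eq_le absB_le ?abs1 //=.
  rewrite -(ler_pM2l vba) mulr1 -absM; apply: le_trans zb _.
  by rewrite {1}zE (_ : (b - a) * (t - 1) = a + (b - a) * t - b) //; ring.
(* In the coordinate [y] with [x = a + (b - a) y], the disc becomes the closed unit disc, [b]
   becomes 1 and [z] becomes [t]. *)
pose c i := u i * (b - a) ^+ i.
pose g y := f (a + (b - a) * y).
have gE y : absp y <= 1 ->
    abs_cvg absp (fun m => \sum_(i < m) c i * y ^+ i) (g y).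
  move=> vy; have := uE (a + (b - a) * y).
  rewrite [_ - a]addrC addKr absM ler_piMr ?abs_ge0 // => /(_ isT).
  rewrite (_ : (fun n => _) = (fun m => \sum_(i < m) c i * y ^+ i)) //.
  apply/funext => m; apply: eq_bigr => i _.
  by rewrite exprMn mulrA.
(* Convergence at the boundary point [y = 1] forces the coefficients to tend to 0. *)
have c_cvg0 (eps : R) : 0 < eps ->
    exists N : nat, forall i, (N <= i)%N -> absp (c i) < eps.
  move=> eps0; have v1 : absp 1 <= 1 by rewrite abs1.
  have [N hN] := abs_cvg_lt (gE _ v1) eps0.
  exists N => i Ni.
  have := absB_lt (hN _ (leqW Ni)) (hN _ Ni).
  rewrite big_ord_recr /= expr1n mulr1.
  by rewrite [X in absp X < _ -> _](_ : _ = c i) //; ring.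
have pow_far y m : absp y <= 1 -> ~~ (absp (y - 1) < 1) ->
    absp (1 - y ^+ (p ^ m)) = 1.
  move=> vy y1; have v1 : absp 1 <= 1 by rewrite abs1.
  apply/eqP; rewrite eq_le absB_le ?absX_le1 //= leNgt absBC.
  by rewrite -{1}(expr1n _ (p ^ m)) (abs_expr_prime_powB_lt1 p_prime vp).
have t_far : ~~ (absp (t - 1) < 1) by rewrite vt1 ltxx.
rewrite tE; have [] := teichmullerP p_prime hCp vt.
move: (teichmuller p absp t) => w vtw vw [l l0 wl].
have w_far : ~~ (absp (w - 1) < 1).
  by apply: contra t_far; apply: abs_trans_lt.
have vw' := pow_far w alpha vw w_far.
set w' := w ^+ (p ^ alpha) in vw' *.
have w'0 : 1 - w' != 0.
  by apply: contra_eq_neq vw' => ->; rewrite abs0 eq_sym oner_neq0.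
suff hL : arc_has_integral p absp a b (Phi alpha%:Z) (fun x => f x / (x - z))
    (f z / (1 - w')).
  split; first by exists (f z / (1 - w')).
  by rewrite (arc_integral_eq hL) mulrC divfK.
(* The slope is the Frobenius period [l] of [w], so that [w' ^ (p ^ (l * k)) = w'] for every [k]. *)
move=> eps eps0; have [phi phiE] := affine_path_seq alpha%:Z l0.
have [N hN] := c_cvg0 _ eps0.
(* Adding 1 keeps the divisor positive when [f z = 0]. *)
have fz1 : 0 < absp (f z) + 1 by rewrite ltr_wpDl ?abs_ge0.
have [M hM] : exists M : nat, forall k, (M <= k)%N ->
    absp ((t ^+ (p ^ alpha)) ^+ (p ^ k) - w' ^+ (p ^ k))
      < eps / (absp (f z) + 1).
  apply: (cvg_expr_prime_powB p_prime vp); rewrite ?absX_le1 ?divr_gt0 //.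
  by rewrite (abs_expr_prime_powB_lt1 p_prime vp).
exists phi, (N + M)%N; split; first by exists l.
move=> k start_k NMk.
have phik : phi k = (alpha + l * k)%N by apply/eqP; rewrite -eqz_nat phiE.
have k_phi : (k <= l * k)%N by exact: leq_pmull.
have n0 : (0 < p ^ phi k)%N by rewrite expn_gt0 p0.
have [rs rs_uniq rsE] := Cp_Xn_sub_1_split hCp n0.
rewrite (arc_mean_seq a b _ rs_uniq rsE).
(* The factor [b - a] cancels: [(x - a) / (x - z) = w / (w - t)]. *)
rewrite (eq_bigr (fun w => w * (g w / (w - t)))); last first.
  move=> y _; rewrite [X in _ / X](_ : _ = (b - a) * (y - t)).
    rewrite invfM; transitivity ((b - a) / (b - a) * (y * (g y / (y - t)))).
      by rewrite /g; ring.
    by rewrite divff // mul1r.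
  by rewrite {1}zE; ring.
have vtn := pow_far t (phi k) vt t_far.
have Nn : (N <= p ^ phi k)%N.
  apply: ltnW; apply: leq_trans (ltn_expl _ (prime_gt1 p_prime)).
  rewrite phik ltnS (leq_trans _ (leq_addl _ _)) // (leq_trans _ k_phi) //.
  exact: leq_trans (leq_addr _ _) (ltnW NMk).
have := abs_unity_mean_lt c_cvg0 gE n0 (Cp_natr_neq0 hCp n0) rs_uniq rsE vt vtn
  eps0 hN Nn.
have -> : g t = f z by rewrite /g -zE.
(* It remains to compare [f z / (1 - t ^ n)] with [f z / (1 - w')]; both denominators have absolute
   value 1. *)
move/abs_trans_lt; apply.
have tn0 : 1 - t ^+ (p ^ phi k) != 0.
  by apply: contra_eq_neq vtn => ->; rewrite abs0 eq_sym oner_neq0.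
have w'k : w' ^+ (p ^ (l * k)) = w'.
  rewrite /w' exprAC; congr (_ ^+ _).
  by elim: (k) => [|j IH]; rewrite ?muln0 ?expr1 // mulnS expnD exprM wl.
have -> : f z / (1 - t ^+ (p ^ phi k)) - f z / (1 - w') =
  f z * (t ^+ (p ^ phi k) - w') / (1 - t ^+ (p ^ phi k)) / (1 - w').
  by field; rewrite tn0 w'0.
rewrite !absM !absV vtn vw' invr1 !mulr1.
have Mlk : (M <= l * k)%N.
  apply: leq_trans k_phi; exact: leq_trans (leq_addl _ _) (ltnW NMk).
have := hM _ Mlk; rewrite w'k -exprM -expnD -phik => h.
apply: le_lt_trans (_ : (absp (f z) + 1) * absp (t ^+ (p ^ phi k) - w') < _).
  by rewrite ler_wpM2r ?abs_ge0 // lerDl.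
by rewrite mulrC -ltr_pdivlMr.
Qed.
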